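(* Let $(n_i)_{i\in I}$ be a family of integers with $n_i\ge 5$, let $\mathcal U$ be an ultrafilter on $I$, and let $\widetilde A_{n_i}$ be the double cover of the alternating group $A_{n_i}$. Then the normal subgroups of the algebraic ultraproduct $\prod_{\mathcal U}\widetilde A_{n_i}$ are linearly ordered by inclusion.
   Context: The double cover of $A_n$ ($n\ge5$) is the perfect central extension of $A_n$ with kernel of order $2$. The algebraic ultraproduct $\prod_{\mathcal U}H_i$ of groups $H_i$ is the quotient of $\prod_{i\in I}H_i$ by the normal subgroup of all $(g_i)$ with $\{i\in I\mid g_i=1\}\in\mathcal U$. *)

(* Defs.v *)
From HB Require Import structures.
From mathcomp Require Import all_boot all_fingroup all_solvable.
From mathcomp Require Import boolp classical_sets filter.

Set Implicit Arguments.
Unset Strict Implicit.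
Unset Printing Implicit Defensive.

Local Open Scope group_scope.

(* [gT], as a whole type, is a perfect central extension of the alternating
   group on ['I_n] with kernel of order 2.  For [5 <= n] this determines [gT]
   up to isomorphism. *)
Definition double_cover (n : nat) (gT : finGroupType) : Prop :=
  [~: [set: gT], [set: gT]] = [set: gT] /\
  exists f : {morphism [set: gT] >-> {perm 'I_n}},
    [/\ f @* [set: gT] = 'Alt_('I_n),
        'ker f \subset 'Z([set: gT]) & #|'ker f| = 2%N].

Local Open Scope classical_set_scope.
Local Open Scope quotient_scope.

(* Possibly infinite groups: subgroups are classical sets, as [{group gT}] and
   [<|] are only available over a [finGroupType]. *)
Definition normal_subgroup (G : groupType) (N : set G) : Prop :=
  group_closed [in N] /\ (forall x g : G, x \in N -> x ^ g \in N).

Section QuotientGroup.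
Variables (G : groupType) (N : set G) (nN : normal_subgroup N).

Let memV x : x \in N -> x^-1 \in N.
Proof. by case: nN => [[N1 ND] _] Nx; rewrite -[_^-1]mul1g; apply: ND. Qed.

Let memM x y : x \in N -> y \in N -> x * y \in N.
Proof.
move=> Nx Ny; case: nN => [[_ ND] _].
by rewrite -[y]invgK; apply: ND => //; apply: memV.
Qed.

Let memJ x g : x \in N -> x ^ g \in N.
Proof. by case: nN => _; apply. Qed.

Definition coset_rel : rel G := fun x y => x^-1 * y \in N.

Let coset_rel_refl : reflexive coset_rel.
Proof. by move=> x; rewrite /coset_rel mulVg; case: nN => [[]]. Qed.

Let coset_rel_sym : symmetric coset_rel.
Proof.
by move=> x y; apply/idP/idP => /memV; rewrite /coset_rel invgM invgK.
Qed.

Let coset_rel_trans : transitive coset_rel.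
Proof.
move=> y x z xy yz; rewrite /coset_rel.
by rewrite -[z](mulKVg y) mulgA; apply: memM.
Qed.

Canonical coset_equiv :=
  EquivRel coset_rel coset_rel_refl coset_rel_sym coset_rel_trans.

Definition quotient_group := {eq_quot coset_equiv}.

HB.instance Definition _ := Choice.copy quotient_group {eq_quot coset_equiv}.

Let Q := quotient_group.
Let cls : G -> Q := fun x => \pi_{eq_quot coset_equiv} x.
Let rep : Q -> G := fun u => generic_quotient.repr (u : {eq_quot coset_equiv}).

Let clsP x y : x^-1 * y \in N -> cls x = cls y.
Proof. by move=> xy; apply/eqP; rewrite /cls eqmodE. Qed.

Let repK u : cls (rep u) = u.
Proof. exact: reprK. Qed.

Let rep_cls x : x^-1 * rep (cls x) \in N.
Proof.
have: cls x == cls (rep (cls x)) by rewrite repK.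
by rewrite /cls eqmodE.
Qed.

Definition quotient_mul (u v : quotient_group) : quotient_group :=
  cls (rep u * rep v).
Definition quotient_one : quotient_group := cls 1.
Definition quotient_inv (u : quotient_group) : quotient_group :=
  cls (rep u)^-1.

Let clsM x y : quotient_mul (cls x) (cls y) = cls (x * y).
Proof.
symmetry; apply: clsP; rewrite invgM.
set x' := rep _; set y' := rep _.
have -> : y^-1 * x^-1 * (x' * y') = (x^-1 * x') ^ y * (y^-1 * y').
  by rewrite /conjg !mulgA mulgK.
by apply: memM; [apply: memJ|]; apply: rep_cls.
Qed.

Let clsV x : quotient_inv (cls x) = cls x^-1.
Proof.
symmetry; apply: clsP; rewrite invgK.
set x' := rep _.
have -> : x * x'^-1 = ((x^-1 * x')^-1) ^ x^-1.
  by rewrite /conjg invgM !invgK !mulgA mulgK.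
by apply: memJ; apply: memV; apply: rep_cls.
Qed.

Fact quotient_mulA : associative quotient_mul.
Proof.
by move=> u v w; rewrite -[u]repK -[v]repK -[w]repK !clsM mulgA.
Qed.
Fact quotient_mul1 : left_id quotient_one quotient_mul.
Proof. by move=> u; rewrite -[u]repK clsM mul1g. Qed.
Fact quotient_mulr1 : right_id quotient_one quotient_mul.
Proof. by move=> u; rewrite -[u]repK clsM mulg1. Qed.
Fact quotient_mulV : left_inverse quotient_one quotient_inv quotient_mul.
Proof. by move=> u; rewrite -[u]repK clsV clsM mulVg. Qed.
Fact quotient_mulrV : right_inverse quotient_one quotient_inv quotient_mul.
Proof. by move=> u; rewrite -[u]repK clsV clsM mulgV. Qed.

HB.instance Definition _ := isGroup.Build quotient_group quotient_mulA
  quotient_mul1 quotient_mulr1 quotient_mulV quotient_mulrV.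

Definition quotient_class (x : G) : quotient_group := cls x.

Lemma quotient_classM : {morph quotient_class : x y / x * y}.
Proof. by move=> x y; symmetry; apply: clsM. Qed.

Lemma quotient_class_eq x y :
  (quotient_class x == quotient_class y) = (x^-1 * y \in N).
Proof. by rewrite /quotient_class /cls eqmodE. Qed.

Lemma quotient_class_surj u : exists x, quotient_class x = u.
Proof. by exists (rep u); apply: repK. Qed.

End QuotientGroup.

Definition product_group (I : Type) (H : I -> groupType) : Type :=
  forall i, H i.

Section ProductGroup.
Variables (I : Type) (H : I -> groupType).

HB.instance Definition _ := gen_eqMixin (product_group H).
HB.instance Definition _ := gen_choiceMixin (product_group H).

Definition product_mul (g h : product_group H) : product_group H :=
  fun i => g i * h i.
Definition product_one : product_group H := fun=> 1.
Definition product_inv (g : product_group H) : product_group H :=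
  fun i => (g i)^-1.

Fact product_mulA : associative product_mul.
Proof.
by move=> f g h; apply: functional_extensionality_dep => i; apply: mulgA.
Qed.
Fact product_mul1 : left_id product_one product_mul.
Proof.
by move=> f; apply: functional_extensionality_dep => i; apply: mul1g.
Qed.
Fact product_mulr1 : right_id product_one product_mul.
Proof.
by move=> f; apply: functional_extensionality_dep => i; apply: mulg1.
Qed.
Fact product_mulV : left_inverse product_one product_inv product_mul.
Proof.
by move=> f; apply: functional_extensionality_dep => i; apply: mulVg.
Qed.
Fact product_mulrV : right_inverse product_one product_inv product_mul.
Proof.
by move=> f; apply: functional_extensionality_dep => i; apply: mulgV.
Qed.

HB.instance Definition _ := isGroup.Build (product_group H) product_mulA
  product_mul1 product_mulr1 product_mulV product_mulrV.

End ProductGroup.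

Section Ultraproduct.
Variables (I : Type) (U : set_system I) (UU : UltraFilter U).
Variable H : I -> groupType.

Definition ultraproduct_kernel : set (product_group H) :=
  [set g | U [set i | g i = 1]].

Lemma ultraproduct_kernel_normal : normal_subgroup ultraproduct_kernel.
Proof.
split; first split.
- rewrite inE; apply: filterS filterT => i _ //.
- move=> g h; rewrite !inE => Ug Uh; apply: filterS2 Ug Uh => i /= gi hi.
  by rewrite [LHS](_ : _ = g i * (h i)^-1) // gi hi mulgV.
- move=> g h; rewrite !inE; apply: filterS => i /= gi.
  by rewrite [LHS](_ : _ = g i ^ h i) // gi conj1g.
Qed.

Definition ultraproduct : groupType :=
  quotient_group ultraproduct_kernel_normal.

End Ultraproduct.

(* Main.v *)
Require Import Defs.
From mathcomp Require Import all_boot all_fingroup all_solvable zify.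

(** The normal subgroups of a group are linearly ordered as soon as, of any two
    elements, one lies in the normal closure of the other.  In an ultraproduct
    this follows from a bound [K], uniform in [n], such that of any two elements
    of the double cover one is a product of at most [K] conjugates of the other
    and its inverse.

    In [A_n], the element moving at least as many points generates the other one
    in boundedly many steps: if [D] is a maximal set disjoint from its image
    under [p], then [D] has at least a third of the support of [p], and
    commutators of [p] with even involutions supported in [D] are involutions
    of controlled size; conversely every even permutation is a product of
    boundedly many such involutions.  Small supports are covered by the
    simplicity of finitely many alternating groups.

    In the cover it remains to reach the central element [z].  Each 3-cycle has
    a unique lift of order 3.  If these lifts satisfied
    [(x y w) = (x y y')(x y' w)], they would generate a subgroup meeting the
    kernel trivially (by induction on the set of moved points), so the
    perfect group would split over its center.  Hence [z] is a product of three
    such lifts or their inverses, which are boundedly generated by any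
    noncentral element. *)

Set Implicit Arguments.
Unset Strict Implicit.
Unset Printing Implicit Defensive.
Local Open Scope group_scope.

(** * Products of boundedly many conjugates *)

Section ClassBall.

Variables (gT : finGroupType) (G : {group gT}).
Implicit Types x y g : gT.

Definition sym_class x : {set gT} := x ^: G :|: x^-1 ^: G.

(** Adjoining 1 lets the [k]-fold product set contain all shorter products, so balls grow with
    [k]. *)
Definition class_ball x k : {set gT} := (1 |: sym_class x) ^+ k.

Lemma class_ball1 x k : 1 \in class_ball x k.
Proof.
elim: k => [|k IH]; first by rewrite /class_ball expg0 set11.
rewrite /class_ball expgS.
by apply/mulsgP; exists 1 1; rewrite ?mulg1 ?in_setU1 ?eqxx.
Qed.

Lemma class_ballM x k l a b :
  a \in class_ball x k -> b \in class_ball x l -> a * b \in class_ball x (k + l).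
Proof. by move=> xa xb; rewrite /class_ball expgD mem_mulg. Qed.

Lemma class_ball_mono x k l : k <= l -> class_ball x k \subset class_ball x l.
Proof.
move=> /subnK <-; apply/subsetP=> a xa.
by rewrite addnC -[a]mulg1 class_ballM ?class_ball1.
Qed.

Lemma sub_class_ball x k l a :
  k <= l -> a \in class_ball x k -> a \in class_ball x l.
Proof. by move/(class_ball_mono x)/subsetP; apply. Qed.

Lemma class_ballJ x k a g :
  a \in class_ball x k -> g \in G -> a ^ g \in class_ball x k.
Proof.
move=> + Gg; elim: k a => [|k IH] a.
  by rewrite /class_ball expg0 => /set1gP->; rewrite conj1g.
rewrite /class_ball expgS => /mulsgP[b c xb xc ->]; rewrite conjMg.
apply: mem_mulg; last exact: IH.
move: xb; rewrite !inE => /or3P[/eqP->|/imsetP[h Gh ->]|/imsetP[h Gh ->]].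
- by rewrite conj1g eqxx.
- by rewrite -conjgM memJ_class ?groupM ?orbT.
- by rewrite -conjgM [X in _ || (_ || X)]memJ_class ?groupM ?orbT.
Qed.

Lemma class_ballV x k a : a \in class_ball x k -> a^-1 \in class_ball x k.
Proof.
elim: k a => [|k IH] a.
  by rewrite /class_ball expg0 => /set1gP->; rewrite invg1.
rewrite {1}/class_ball expgS => /mulsgP[b c xb xc ->].
rewrite invMg -addn1 class_ballM ?IH // /class_ball expg1.
move: xb; rewrite !inE => /or3P[/eqP->|/imsetP[h Gh ->]|/imsetP[h Gh ->]].
- by rewrite invg1 eqxx.
- by rewrite -conjVg memJ_class ?orbT.
- by rewrite -conjVg invgK memJ_class ?orbT.
Qed.

Lemma class_ball_id x : x \in class_ball x 1.
Proof. by rewrite /class_ball expg1 !inE class_refl orbT. Qed.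

Lemma class_ball_trans x y a k l :
  y \in class_ball x k -> a \in class_ball y l -> a \in class_ball x (l * k).
Proof.
move=> xy; elim: l a => [|l IH] a; first by rewrite /class_ball !expg0.
rewrite {1}/class_ball expgS => /mulsgP[b c yb yc ->].
rewrite mulSn class_ballM ?IH //.
move: yb; rewrite !inE => /or3P[/eqP->|/imsetP[h Gh ->]|/imsetP[h Gh ->]].
- exact: class_ball1.
- exact: class_ballJ.
- by apply: class_ballJ => //; apply: class_ballV.
Qed.

Lemma class_ballX x a k m :
  a \in class_ball x k -> a ^+ m \in class_ball x (m * k).
Proof.
move=> xa; apply: class_ball_trans xa _.
elim: m => [|m IH]; first by rewrite expg0 class_ball1.
by rewrite expgS -add1n class_ballM ?class_ball_id.
Qed.

(** The symmetric class of [x] generates a nontrivial normal subgroup, hence [G]; by finiteness a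
    single power of the class with 1 adjoined already fills it. *)
Lemma class_ball_simple x :
  simple G -> x \in G -> x != 1 -> exists k, G \subset class_ball x k.
Proof.
case/simpleP=> _ simG Gx x1; have [k defH] := gen_expgs (sym_class x).
exists k; rewrite -/(class_ball x k) in defH.
suffices <-: <<sym_class x>>%G = G by rewrite /= -defH.
have sG : sym_class x \subset G.
  by rewrite subUset !class_subG ?groupV.
have nG : <<sym_class x>>%G <| G.
  apply/andP; split; first by rewrite gen_subG.
  by apply: subset_trans (norm_gen _); rewrite normsU ?class_norm.
have [H1|H1] := simG _ nG; last exact: group_inj H1.
have: x \in <<sym_class x>> by apply: mem_gen; rewrite inE class_refl.
by move: H1 => /= ->; rewrite inE (negPf x1).
Qed.

End ClassBall.

(** Stated for a bare multiplicative map, the form in which extension of permutations by the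
    identity is available. *)
Lemma class_ball_morph (gT rT : finGroupType) (G : {group gT}) (H : {group rT})
    (f : gT -> rT) (x y : gT) k :
    (forall a b, f (a * b) = f a * f b) -> (forall g, g \in G -> f g \in H) ->
  y \in class_ball G x k -> f y \in class_ball H (f x) k.
Proof.
move=> fM fG.
have f1 : f 1 = 1 by apply: (mulgI (f 1)); rewrite -fM !mulg1.
have fV a : f a^-1 = (f a)^-1.
  by apply: (mulgI (f a)); rewrite -fM !mulgV f1.
have fJ a b : f (a ^ b) = f a ^ f b by rewrite /conjg !fM fV.
elim: k y => [|k IH] y.
  by rewrite /class_ball !expg0 => /set1gP->; rewrite f1.
rewrite /class_ball !expgS => /mulsgP[b c xb xc ->]; rewrite fM.
apply: mem_mulg; last exact: IH.
move: xb; rewrite !inE => /or3P[/eqP->|/imsetP[h Gh ->]|/imsetP[h Gh ->]].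
- by rewrite f1 eqxx.
- by rewrite fJ memJ_class ?orbT ?fG.
- by rewrite fJ fV memJ_class ?orbT ?fG.
Qed.

(** * Products of transpositions encoded by lists *)

Section Transpositions.

Variable T : finType.
Implicit Types (x y : T) (s : seq T) (g : {perm T}).

(** For a duplicate-free list this squares to 1 and its cycle type depends only on the length, so
    conjugacy questions become questions about list lengths. *)
Fixpoint tperms s : {perm T} :=
  if s is x :: y :: s' then tperm x y * tperms s' else 1.

Lemma seq_ind2 (P : seq T -> Prop) :
    P [::] -> (forall x y s, ~~ odd (size s) -> P s -> P [:: x, y & s]) ->
  forall s, ~~ odd (size s) -> P s.
Proof.
move=> P0 P2 s; have [m] := ubnP (size s).
elim: m s => // m IH [|x [|y s]] //= /ltnW ltm; rewrite negbK => es.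
by apply: P2 => //; apply: IH => //; exact: ltm.
Qed.

Lemma tperms_map g s : tperms (map g s) = tperms s ^ g.
Proof.
have [m] := ubnP (size s).
elim: m s => // m IH [|x [|y s]] /= /ltnW ltm; rewrite ?conj1g //.
by rewrite conjMg tpermJ IH //.
Qed.

Lemma tperms_cat s1 s2 :
  ~~ odd (size s1) -> tperms (s1 ++ s2) = tperms s1 * tperms s2.
Proof.
move=> es1; elim/seq_ind2: s1 / es1 => [|x y s _ IH] /=; first by rewrite mul1g.
by rewrite IH mulgA.
Qed.

Lemma tperms_out s x : x \notin s -> tperms s x = x.
Proof.
have [m] := ubnP (size s).
elim: m s => // m IH [|a [|b s]] /= /ltnW ltm; rewrite ?perm1 //.
rewrite !inE !negb_or => /and3P[xa xb xs].
by rewrite permM tpermD 1?eq_sym // IH //.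
Qed.

(** Conjugation by the second product fixes every entry of the first list, hence the first
    product. *)
Lemma tperms_disjoint s1 s2 :
  ~~ has [in s1] s2 -> tperms s1 * tperms s2 = tperms s2 * tperms s1.
Proof.
move=> d; rewrite conjgC -tperms_map; congr (_ * tperms _).
rewrite -[RHS]map_id; apply/eq_in_map=> x s1x; apply: tperms_out.
by apply: contra d => s2x; apply/hasP; exists x.
Qed.

Lemma odd_tperms s : uniq s -> ~~ odd (size s) -> tperms s = odd (size s)./2 :> bool.
Proof.
move=> + es; elim/seq_ind2: s / es => [|x y s _ IH] /=; first by rewrite odd_perm1.
rewrite inE negb_or => /and3P[/andP[xy _] _ us].
by rewrite odd_mul_tperm xy IH.
Qed.

Lemma tperms_sq s : uniq s -> tperms s * tperms s = 1.
Proof.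
have [m] := ubnP (size s).
elim: m s => // m IH [|x [|y s]] /= /ltnW ltm; rewrite ?mulg1 //.
rewrite inE negb_or -andbA => /and4P[xy xs ys us].
have c : tperm x y * tperms s = tperms s * tperm x y.
  have := @tperms_disjoint [:: x; y] s; rewrite /= mulg1; apply.
  apply/hasPn=> z zs; rewrite !inE negb_or.
  by apply/andP; split; apply: contraTneq zs => ->.
by rewrite {1}c mulgA -(mulgA _ _ (tperm x y)) tperm2 mulg1 IH.
Qed.

End Transpositions.

(** * Involutions as products of transpositions *)

Section Involutions.

Variable T : finType.
Implicit Types (x y : T) (s t u : seq T) (p g h : {perm T}).

Definition moved p : {set T} := [set x | p x != x].

Lemma notin_moved p x : (x \notin moved p) = (p x == x).
Proof. by rewrite inE negbK. Qed.

Lemma involution_tperms h :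
    h * h = 1 ->
  exists s, [/\ uniq s, ~~ odd (size s), {subset s <= moved h} & h = tperms s].
Proof.
have [m] := ubnP #|moved h|; elim: m h => // m IH h /ltnSE le_m h2.
have hK z : h (h z) = z by rewrite -permM h2 perm1.
have [x hx|h1] := pickP [in moved h]; last first.
  exists [::]; split=> //; apply/permP=> z; rewrite perm1.
  by apply/eqP; rewrite -notin_moved; apply: negbT (h1 z).
have hxx : h x != x by rewrite inE in hx.
(* Removing the 2-cycle through [x] leaves an involution that fixes [x] and [h x] and agrees with
   [h] elsewhere. *)
pose h' := tperm x (h x) * h.
have ch : tperm x (h x) * h = h * tperm x (h x).
  by rewrite conjgC tpermJ hK tpermC.
have h'E z : h' z = if (z == x) || (z == h x) then z else h z.
  rewrite permM; case: tpermP => [->|->|/eqP/negPf-> /eqP/negPf->] //=.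
    by rewrite eqxx hK.
  by rewrite eqxx orbT.
have sub : moved h' \subset moved h :\ x.
  apply/subsetP=> z; rewrite !inE h'E.
  by case: ifPn => [_|/norP[-> _] //]; rewrite eqxx.
have [||s [us es sh Es]] := IH h'.
- apply: leq_trans le_m; rewrite [ltnRHS](cardsD1 x) hx.
  by rewrite ltnS subset_leq_card.
- by rewrite {1}/h' ch /h' mulgA -(mulgA h) tperm2 mulg1.
exists [:: x, h x & s]; split=> /=.
- rewrite us inE eq_sym (negPf hxx) andbT /=.
  by apply/andP; split; apply/negP => /sh; rewrite inE h'E eqxx ?orbT eqxx.
- by rewrite negbK.
- move=> z; rewrite 2!inE => /or3P[/eqP->|/eqP->|/sh/(subsetP sub)] //.
  + by rewrite inE hK eq_sym.
  + by rewrite inE => /andP[].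
- by rewrite -Es /h' mulgA tperm2 mul1g.
Qed.

(** A rotation is a product of two reflections: numbering each cycle from a base point, [j -> -j]
    followed by [j -> 1 - j] is [j -> j + 1]. *)
Lemma perm_mul_involutions p :
  exists h1 h2, [/\ h1 * h1 = 1, h2 * h2 = 1, moved h1 \subset moved p,
                    moved h2 \subset moved p & p = h1 * h2].
Proof.
(* [r x] is a base point depending only on the cycle of [x]; [i x] below is the position of [x]
   counted from it, and [f] reverses positions. *)
pose r x := odflt x [pick y in porbit p x].
have r_in x : r x \in porbit p x.
  by rewrite /r; case: pickP => //= /(_ x); rewrite porbit_id.
have rE x y : y \in porbit p x -> r y = r x.
  rewrite -eq_porbit_mem => /eqP e; rewrite /r.
  have -> : [pick z in porbit p y] = [pick z in porbit p x].
    by apply: eq_pick => z /=; rewrite e.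
  by case: pickP => //= /(_ x); rewrite porbit_id.
have r_ex x : exists i, x == (p ^+ i) (r x).
  have := r_in x; rewrite porbit_sym => /porbitP[i e]; by exists i; apply/eqP.
pose i x := ex_minn (r_ex x).
have iE x : (p ^+ i x) (r x) = x.
  by rewrite /i; case: ex_minnP => j /eqP <-.
pose f x := (p^-1 ^+ i x) (r x).
have fE j x : f ((p ^+ j) (r x)) = (p^-1 ^+ j) (r x).
  set y := (p ^+ j) (r x).
  have ry : r y = r x by rewrite (rE (r x)) ?mem_porbit // (rE x) ?r_in.
  rewrite /f ry; have := iE y; rewrite ry => e.
  apply: (@perm_inj _ (p ^+ (i y + j))); rewrite expgD -!permM !mulgA.
  rewrite expgVn mulVg mul1g -(mulgA _ (p ^+ i y)).
  have -> : p ^+ i y * p ^+ j = p ^+ j * p ^+ i y by rewrite -!expgD addnC.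
  by rewrite mulgA expgVn mulVg mul1g e.
(* Writing the inverse as a nonnegative power puts [f x] in the form required by [fE]. *)
have [m Em] : exists m, p^-1 = p ^+ m by exists #[p].-1; rewrite invg_expg.
have Em' : p = p^-1 ^+ m by rewrite expgVn -Em invgK.
have ff x : f (f x) = x.
  rewrite {2}/f {1}Em -expgM fE expgM -Em'; exact: iE.
pose h := perm (can_inj ff).
have hh : h * h = 1 by apply/permP=> x; rewrite permM perm1 !permE ff.
exists h, (h * p); split=> //; last by rewrite mulgA hh mul1g.
- apply/permP=> x; rewrite !permM perm1 !permE.
  have -> : p (f x) = (p ^+ (m * i x).+1) (r x).
    by rewrite /f Em -expgM expgSr permM.
  by rewrite fE expgSr permM permKV expgM -Em' iE.
- apply/subsetP=> x; rewrite !inE permE; apply: contra => /eqP px.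
  have pVx : p^-1 x = x by rewrite -{1}px permK.
  have rx : r x = x.
    by rewrite -[LHS](permK (p ^+ i x)) iE -expgVn permX_fix.
  by rewrite /f rx permX_fix.
- apply/subsetP=> x; rewrite !inE permM permE; apply: contra => /eqP px.
  have pVx : p^-1 x = x by rewrite -{1}px permK.
  have rx : r x = x.
    by rewrite -[LHS](permK (p ^+ i x)) iE -expgVn permX_fix.
  by rewrite /f rx permX_fix // px.
Qed.

Lemma seq_conj s t :
  uniq s -> uniq t -> size s = size t -> exists g, map g s = t.
Proof.
move=> us ut e.
have le : size s <= #|T| by rewrite -(card_uniqP us) max_card.
have tr := ntransitive_weak le (Sym_trans T).
have S1 : in_tuple s \in dtuple_on (size s) setT.
  by rewrite inE us; apply/subsetP.
have S2 : tcast (esym e) (in_tuple t) \in dtuple_on (size s) setT.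
  by rewrite inE val_tcast ut; apply/subsetP.
have [g _ /(congr1 val)/= E] := atransP2 tr S1 S2.
by exists g; rewrite val_tcast /= in E; rewrite E.
Qed.

(** An odd conjugating permutation is made even by composing it with the first transposition of the
    product, which centralizes the product. With fewer than two entries both products are 1. *)
Lemma tperms_conj s t :
    uniq s -> uniq t -> size s = size t ->
  exists2 g, g \in 'Alt_T & tperms t = tperms s ^ g.
Proof.
move=> us ut e; have [g Eg] := seq_conj us ut e; have := tperms_map g s.
rewrite Eg => E; case og: (odd_perm g); last by exists g; rewrite // Alt_even og.
case: s us {e} E Eg => [|x [|y s]] us E Eg.
- by exists 1; rewrite ?group1 // E !conj1g.
- by exists 1; rewrite ?group1 // E !conj1g.
exists (tperm x y * g).
  by rewrite Alt_even odd_mul_tperm og; move: us; rewrite /= inE negb_or; case: (x == y).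
have c : tperms [:: x, y & s] ^ tperm x y = tperms [:: x, y & s].
  rewrite conjgE /= tpermV !mulgA tperm2 mul1g.
  have := @tperms_disjoint _ [:: x; y] s; rewrite /= mulg1 => -> //.
  apply/hasPn=> z zs; rewrite !inE negb_or; case/and3P: us => /norP[_ xs] ys _.
  by apply/andP; split; apply: contraTneq zs => ->.
by rewrite conjgM c.
Qed.

(* On each block, [(a b)(c d) = (a c)(b d) * (a d)(b c)]. *)
Lemma tperms_split k s :
    uniq s -> size s = (4 * k)%N ->
  exists v w, [/\ perm_eq v s, perm_eq w s & tperms s = tperms v * tperms w].
Proof.
elim: k s => [|k IH] s us; first by move/size0nil->; exists [::], [::]; rewrite /= mulg1.
rewrite mulnS; case: s us => [|a [|b [|c [|d s]]]] //= us [] /IH[].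
  by case/and5P: us.
move=> v [w [pv pw E]].
have us' : uniq ([:: a; b; c; d] ++ s) by [].
have db x : x \in [:: a; b; c; d] -> x \notin s.
  move: us'; rewrite cat_uniq => /and3P[_ /hasPn h _] xb.
  by apply: contraL xb => /h.
exists [:: a, c, b, d & v], [:: a, d, b, c & w].
have h1 : perm_eq [:: a, c, b, d & v] [:: a, b, c, d & s].
  rewrite perm_cons -[[:: c, b, d & v]]/([:: c; b] ++ d :: v).
  by rewrite -[[:: b, c, d & s]]/([:: b; c] ++ d :: s) perm_cat ?perm_cons // (perm_catC [:: c] [:: b]).
have h2 : perm_eq [:: a, d, b, c & w] [:: a, b, c, d & s].
  rewrite perm_cons -[[:: d, b, c & w]]/([:: d; b; c] ++ w).
  by rewrite -[[:: b, c, d & s]]/([:: b; c; d] ++ s) perm_cat // (perm_catC [:: d] [:: b; c]).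
split=> //=; rewrite E.
have := @tperms_disjoint _ [:: a; d; b; c] v; rewrite /= mulg1 => cm.
have {cm}cm : tperm a d * tperm b c * tperms v = tperms v * (tperm a d * tperm b c).
  apply: cm; apply/hasPn=> x; rewrite (perm_mem pv) => xs.
  apply: contraL xs => xb; apply: db; move: xb; rewrite !inE.
  by case/or4P=> ->; rewrite ?orbT.
have key : tperm a b * tperm c d = tperm a c * tperm b d * (tperm a d * tperm b c).
  move: us'; rewrite cat_uniq /= !inE !negb_or => /andP[+ _].
  case/andP=> /and3P[ab ac ad] /andP[/andP[bc bd] /andP[cd _]].
  apply/permP=> x; rewrite !permM.
  move: ab ac ad bc bd cd => /eqP ab /eqP ac /eqP ad /eqP bc /eqP bd /eqP cd.
  by do ?case: tpermP; congruence.
by rewrite !mulgA key -!mulgA; congr (_ * (_ * _)); rewrite !mulgA cm !mulgA.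
Qed.

End Involutions.

Lemma quarterK m : ~~ odd m -> ~~ odd m./2 -> m = (4 * m./2./2)%N.
Proof. by move=> /even_halfK e /even_halfK e'; lia. Qed.

(** * Even permutations from conjugates of one even involution *)

Section InvolutionBalls.

Variable T : finType.
Implicit Types (x y : T) (s t u : seq T) (p g h : {perm T}).

(** After splitting into two products on the points of [s], the same padding [r] is inserted in
    both. It cancels, being of square 1, and brings both lists to length [4 l], where each product
    is conjugate to [tperms u]. *)
Lemma tperms_ball k l s u :
    uniq s -> uniq u -> size s = (4 * k)%N -> size u = (4 * l)%N -> k <= l ->
  tperms s \in class_ball 'Alt_T (tperms u) 2.
Proof.
move=> us uu es eu kl.
have [v [w [pv pw ->]]] := tperms_split us es.
pose r := take (4 * (l - k)) (enum [predC s]).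
have ur : uniq r by rewrite take_uniq ?enum_uniq.
have rs x : x \in r -> x \notin s by move/mem_take; rewrite mem_enum inE.
(* There is room for the padding because [u] already has [4 l] distinct entries. *)
have er : size r = (4 * (l - k))%N.
  have le_u : size u <= #|T| by rewrite -(card_uniqP uu) max_card.
  have cs : (size s + #|[predC s]|)%N = #|T| by rewrite -(card_uniqP us) cardC.
  rewrite size_take -cardE; case: ltnP => // h; move: cs le_u h; rewrite es eu.
  by move: #|[predC s]| #|T| => a b; lia.
have sq := tperms_sq ur.
have -> : tperms v * tperms w = tperms (v ++ r) * tperms (r ++ w).
  rewrite !tperms_cat ?(perm_size pv) ?er ?es ?oddM //.
  by rewrite mulgA -(mulgA (tperms v)) sq mulg1.
have in1 t : uniq t -> size t = (4 * l)%N ->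
    tperms t \in class_ball 'Alt_T (tperms u) 1.
  move=> ut et; have [|g Ag ->] := tperms_conj uu ut; first by rewrite eu et.
  by rewrite class_ballJ ?class_ball_id.
rewrite -[2]/(1 + 1)%N class_ballM // in1 //.
- rewrite cat_uniq (perm_uniq pv) us ur andbT /=.
  by apply/hasPn=> x /rs; rewrite (perm_mem pv).
- by rewrite size_cat (perm_size pv) es er; lia.
- rewrite cat_uniq (perm_uniq pw) us ur /= andbT.
  by apply/hasPn=> x; rewrite (perm_mem pw); apply: contraL => /rs.
- by rewrite size_cat (perm_size pw) es er; lia.
Qed.

(** The list is cut into three pieces of at most [4 l] entries, each costing two conjugates. *)
Lemma tperms_ball3 k l s u :
    uniq s -> uniq u -> size s = (4 * k)%N -> size u = (4 * l)%N -> k <= 3 * l ->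
  tperms s \in class_ball 'Alt_T (tperms u) 6.
Proof.
move=> us uu es eu kl.
have step m s' : uniq s' -> size s' = (4 * m)%N -> exists s1 s2,
    [/\ uniq s1 /\ size s1 = (4 * minn m l)%N, uniq s2,
        size s2 = (4 * (m - l))%N & tperms s' = tperms s1 * tperms s2].
  move=> us' es'; exists (take (4 * l) s'), (drop (4 * l) s'); split.
  - by rewrite take_uniq // size_take es'; split => //; case: ltnP; lia.
  - by rewrite drop_uniq.
  - by rewrite size_drop es'; lia.
  rewrite -tperms_cat ?cat_take_drop // size_take es'.
  by case: ifP; rewrite oddM.
have [s1 [s2 [[us1 es1] us2 es2 ->]]] := step _ _ us es.
have [s3 [s4 [[us3 es3] us4 es4 ->]]] := step _ _ us2 es2.
rewrite -[6]/(2 + (2 + 2))%N !class_ballM //.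
- by apply: (tperms_ball us1 uu es1 eu); lia.
- by apply: (tperms_ball us3 uu es3 eu); lia.
- by apply: (tperms_ball us4 uu es4 eu); lia.
Qed.

(** If the transpositions overlap they involve at most three points, so a transposition of two
    further points can be inserted twice, giving two disjoint pairs. *)
Lemma tperm2_ball l u x y x' y' :
    5 <= #|T| -> 0 < l -> uniq u -> size u = (4 * l)%N ->
    x != y -> x' != y' ->
  tperm x y * tperm x' y' \in class_ball 'Alt_T (tperms u) 4.
Proof.
move=> T5 l0 uu eu xy xy'.
have in2 a b c d : uniq [:: a; b; c; d] ->
    tperm a b * tperm c d \in class_ball 'Alt_T (tperms u) 2.
  move=> us; rewrite -[_ * tperm c d]/(tperm a b * (tperm c d)) -[tperm c d]mulg1.
  exact: (@tperms_ball 1 l [:: a; b; c; d]).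
have [us|nus] := boolP (uniq [:: x; y; x'; y']).
  by apply: (@sub_class_ball _ _ _ 2); rewrite ?in2.
pose E := [set z in [:: x; y; x'; y']].
have cE : #|E| <= 3.
  rewrite cardsE; have := card_size [:: x; y; x'; y'].
  by rewrite leq_eqVlt => /orP[/eqP/card_uniqP/idPn|].
have : 1 < #|~: E| by rewrite cardsCs setCK; lia.
case/card_gt1P=> a [b [aE bE ab]].
move: aE bE; rewrite !inE !negb_or.
move=> /and4P[ax ay ax' ay'] /and4P[bx b_y bx' by'].
rewrite -(mulg1 (tperm x y)) -(tperm2 a b) -!mulgA mulgA.
have u1 : uniq [:: x; y; a; b].
  rewrite /= !inE !negb_or xy ab.
  by rewrite ![x == _]eq_sym ![y == _]eq_sym ax ay bx b_y.
have u2 : uniq [:: a; b; x'; y'] by rewrite /= !inE !negb_or ab xy' ax' ay' bx' by'.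
by rewrite -[4]/(2 + 2)%N class_ballM ?in2.
Qed.

(** The permutation is a product of two involutions of equal parity. Even ones have lists of length
    divisible by 4, so the bound [12 l + 3] amounts to [12 l] and each costs 6; odd ones first lose
    a transposition each, and the pair removed costs 4. *)
Lemma even_perm_ball l u p :
    5 <= #|T| -> 0 < l -> uniq u -> size u = (4 * l)%N ->
    p \in 'Alt_T -> #|moved p| <= 12 * l + 3 ->
  p \in class_ball 'Alt_T (tperms u) 16.
Proof.
move=> T5 l0 uu eu Ap le_p.
have [h1 [h2 [sq1 sq2 sub1 sub2 Ep]]] := perm_mul_involutions p.
have [s1 [us1 es1 ss1 E1]] := involution_tperms sq1.
have [s2 [us2 es2 ss2 E2]] := involution_tperms sq2.
have le_s s (h : {perm T}) : uniq s -> {subset s <= moved h} ->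
    moved h \subset moved p -> size s <= 12 * l + 3.
  move=> us ss /subset_leq_card sub; apply: leq_trans (leq_trans sub le_p).
  by rewrite -(card_uniqP us); apply: subset_leq_card; apply/subsetP.
have le1 := le_s _ _ us1 ss1 sub1; have le2 := le_s _ _ us2 ss2 sub2.
have in6 s k : uniq s -> size s = (4 * k)%N -> size s <= 12 * l + 3 ->
    tperms s \in class_ball 'Alt_T (tperms u) 6.
  by move=> us es le; apply: (tperms_ball3 us uu es eu); lia.
move: Ap; rewrite Alt_even Ep E1 E2 odd_permM !odd_tperms // => par.
have [odd1|even1] := boolP (odd (size s1)./2); last first.
  have even2 : ~~ odd (size s2)./2 by move: par; rewrite (negPf even1).
  apply: (@sub_class_ball _ _ _ (6 + 6)) => //; apply: class_ballM.
    by apply: (in6 s1 ((size s1)./2)./2) => //; exact: quarterK.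
  by apply: (in6 s2 ((size s2)./2)./2) => //; exact: quarterK.
have odd2 : odd (size s2)./2 by move: par; rewrite odd1; case: odd.
(* Inverting the first involution moves its leading transposition to the end, next to that of the
   second. *)
have {E1}E1 : tperms s1 = (tperms s1)^-1.
  by apply: (mulgI (tperms s1)); rewrite mulgV tperms_sq.
rewrite E1.
case: s1 s2 us1 us2 es1 es2 {ss1 ss2 E1 E2 par} le1 le2 odd1 odd2.
  by [].
move=> x [|y s1] // [|x' [|y' s2]] //= us1 us2 es1 es2 le1 le2 odd1 odd2.
rewrite invMg tpermV !mulgA -(mulgA _ (tperm x y)).
case/and3P: us1; rewrite inE negb_or => /andP[xy _] _ us1.
case/and3P: us2; rewrite inE negb_or => /andP[xy' _] _ us2.
move: es1 es2; rewrite !negbK => es1 es2.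
rewrite -[16]/(6 + 4 + 6)%N !class_ballM ?class_ballV //.
- by apply: (in6 s1 ((size s1)./2)./2) => //; [exact: quarterK | lia].
- exact: (tperm2_ball _ _ _ eu xy xy').
- by apply: (in6 s2 ((size s2)./2)./2) => //; [exact: quarterK | lia].
Qed.

End InvolutionBalls.

(** * Uniform generation in alternating groups *)

Section PermExtension.

Variables (S T : finType) (phi : S -> T).
Hypothesis phi_inj : injective phi.
Implicit Types p q : {perm S}.

Definition perm_ext_fun p x :=
  if [pick i | phi i == x] is Some i then phi (p i) else x.

Lemma perm_ext_fun_im p i : perm_ext_fun p (phi i) = phi (p i).
Proof.
rewrite /perm_ext_fun; case: pickP => [j /eqP/phi_inj-> //|/(_ i)].
by rewrite eqxx.
Qed.

Lemma perm_ext_fun_out p x : x \notin codom phi -> perm_ext_fun p x = x.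
Proof.
rewrite /perm_ext_fun; case: pickP => [j /eqP<-|//].
by rewrite codom_f.
Qed.

Lemma perm_ext_funK p : cancel (perm_ext_fun p) (perm_ext_fun p^-1).
Proof.
move=> x; have [/codomP[i ->]|xo] := boolP (x \in codom phi).
  by rewrite !perm_ext_fun_im permK.
by rewrite !perm_ext_fun_out ?perm_ext_fun_out.
Qed.

Definition perm_ext p := perm (can_inj (perm_ext_funK p)).

Lemma perm_ext_im p i : perm_ext p (phi i) = phi (p i).
Proof. by rewrite permE perm_ext_fun_im. Qed.

Lemma perm_ext_out p x : x \notin codom phi -> perm_ext p x = x.
Proof. by move=> xo; rewrite permE perm_ext_fun_out. Qed.

Lemma perm_extP p (g : {perm T}) :
    (forall i, g (phi i) = phi (p i)) ->
    (forall x, x \notin codom phi -> g x = x) ->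
  perm_ext p = g.
Proof.
move=> gi go; apply/permP=> x.
have [/codomP[i ->]|xo] := boolP (x \in codom phi); first by rewrite perm_ext_im gi.
by rewrite perm_ext_out ?go.
Qed.

Lemma perm_extM p q : perm_ext (p * q) = perm_ext p * perm_ext q.
Proof.
apply: perm_extP => [i|x xo]; first by rewrite !permM !perm_ext_im.
by rewrite permM !perm_ext_out ?perm_ext_out.
Qed.

Lemma perm_ext1 : perm_ext 1 = 1.
Proof. by apply: perm_extP => [i|x xo]; rewrite !perm1. Qed.

Lemma perm_ext_tperm i j : perm_ext (tperm i j) = tperm (phi i) (phi j).
Proof.
apply: perm_extP => [k|x xo]; first by rewrite inj_tperm.
by rewrite tpermD //; apply: contraNneq xo => <-; rewrite codom_f.
Qed.

Lemma odd_perm_ext p : perm_ext p = p :> bool.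
Proof.
have [ts -> _] := prod_tpermP p; elim: ts => [|[i j] ts IH].
  by rewrite big_nil perm_ext1 !odd_perm1.
by rewrite big_cons perm_extM perm_ext_tperm !odd_mul_tperm IH (inj_eq phi_inj).
Qed.

Lemma perm_ext_onto (g : {perm T}) :
  {subset moved g <= codom phi} -> exists p, perm_ext p = g.
Proof.
move=> sub.
have gcod i : g (phi i) \in codom phi.
  have [e|] := boolP (g (phi i) == phi i); first by rewrite (eqP e) codom_f.
  by move=> ne; apply: sub; rewrite inE (inj_eq perm_inj).
pose f i := iinv (gcod i).
have fE i : phi (f i) = g (phi i) by rewrite /f f_iinv.
have f_inj : injective f.
  by move=> i j /(congr1 phi); rewrite !fE => /perm_inj/phi_inj.
exists (perm f_inj); apply: perm_extP => [i|x xo]; first by rewrite permE fE.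
by apply/eqP; rewrite -notin_moved; apply: contra xo => /sub.
Qed.

End PermExtension.

(** Only finitely many pairs of a degree and a permutation occur; simplicity bounds each one, and
    the maximum serves for all. *)
Lemma Alt_ball_bounded m :
  exists K, forall k (p : {perm 'I_k}),
    5 <= k <= m -> p \in 'Alt_('I_k) -> p != 1 ->
  'Alt_('I_k) \subset class_ball 'Alt_('I_k) p K.
Proof.
elim: m => [|m [K IH]].
  by exists 0 => k p /andP[k5 /(leq_trans k5)].
(* The conditions stand under the existential so that the bound is a total function of [p], over
   which a maximum can be taken. *)
have ex (p : {perm 'I_m.+1}) : exists l, 5 <= m.+1 -> p \in 'Alt_('I_m.+1) ->
    p != 1 -> 'Alt_('I_m.+1) \subset class_ball 'Alt_('I_m.+1) p l.
  have [m5|] := boolP (5 <= m.+1); last by exists 0.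
  have [Ap|] := boolP (p \in _); last by exists 0.
  have [p1|] := boolP (p != 1); last by exists 0.
  have simA : simple 'Alt_('I_m.+1) by apply: simple_Alt5; rewrite card_ord.
  by have [l sub] := class_ball_simple simA Ap p1; exists l.
have [f fP] := fin_all_exists ex.
exists (maxn K (\max_p f p)) => k p /andP[k5]; rewrite leq_eqVlt => /orP[/eqP ek|km] Ap p1.
  move: p k5 Ap p1; rewrite ek => p k5 Ap p1.
  apply: subset_trans (fP p k5 Ap p1) _; apply: class_ball_mono.
  by rewrite leq_max leq_bigmax orbT.
apply: subset_trans (IH k p _ Ap p1) _; first by rewrite k5.
by apply: class_ball_mono; rewrite leq_maxl.
Qed.

(** A moved point outside [D], its image and its preimage could be added to a maximal [D]; hence
    these three sets of equal size cover the moved points. *)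
Lemma displaced_set (T : finType) (p : {perm T}) :
  exists D : {set T}, [disjoint D & p @: D] /\ #|moved p| <= 3 * #|D|.
Proof.
pose P (D : {set T}) := [disjoint D & p @: D].
have P0 : P set0 by rewrite /P imset0 -setI_eq0 setI0.
have [D /maxsetP[PD maxD] _] := maxset_exists P0.
exists D; split=> //.
have sub : moved p \subset D :|: p @: D :|: p^-1 @: D.
  apply/subsetP=> x; rewrite inE => px; rewrite !inE.
  have [//|xD] := boolP (x \in D); have [//|xpD] := boolP (x \in p @: D).
  rewrite im_permV inE /=; apply: contraR xD => pxD.
  rewrite -(maxD (x |: D)) ?setU11 ?subsetUr //.
  rewrite /P imsetU1 disjoints_subset; apply/subsetP=> y.
  rewrite !inE => /orP[/eqP->|yD]; rewrite negb_or.
    by rewrite eq_sym px.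
  apply/andP; split; first by apply: contraNneq pxD => <-.
  by rewrite (disjointFr PD yD).
apply: leq_trans (subset_leq_card sub) _.
have := leq_card_setU (D :|: p @: D) (p^-1 @: D).
have := leq_card_setU D (p @: D).
rewrite !(card_imset _ perm_inj) => h1 h2.
apply: leq_trans (leq_of_leqif h2) _.
by rewrite !mulSn mul0n addn0 addnA leq_add2r; apply: leq_of_leqif h1.
Qed.

Lemma perm_ball_tperms :
  exists K, forall (T : finType) (p : {perm T}),
    5 <= #|T| -> p \in 'Alt_T -> p != 1 ->
  exists l u, [/\ 0 < l, uniq u, size u = (4 * l)%N, #|moved p| <= 12 * l + 3
                & tperms u \in class_ball 'Alt_T p K].
Proof.
(* If [D] has at most 3 points, at most 9 points are moved. *)
have [K0 K0P] := Alt_ball_bounded 9.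
exists (maxn 2 K0) => T p T5 Ap p1.
have [D [dD leD]] := displaced_set p.
have [D4|D3] := leqP 4 #|D|.
  (* Using [4 j] points of [D] makes [tperms s] even. Its commutator with [p] has a list of [8 j]
     points, whence [l = 2 j]; since [j > 0], the bound [3 (4 j + 3)] on moved points is at most
     [24 j + 3]. *)
  pose j := #|D| %/ 4.
  pose s := take (4 * j) (enum D).
  have us : uniq s by rewrite take_uniq ?enum_uniq.
  have es : size s = (4 * j)%N.
    have le: 4 * j <= #|D| by rewrite mulnC leq_divM.
    by rewrite size_take -cardE; move: le; case: ltngtP.
  have sD x : x \in s -> x \in D by move/mem_take; rewrite mem_enum.
  exists (2 * j)%N, (map p s ++ s); split.
  - by rewrite muln_gt0 divn_gt0.
  - rewrite cat_uniq us andbT (map_inj_uniq perm_inj) us /=.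
    apply/hasPn=> x /sD xD; apply/mapP=> -[y /sD yD exy].
    by move: (disjointFr dD xD); rewrite exy imset_f.
  - by rewrite size_cat size_map es; lia.
  - have := divn_eq #|D| 4; have := ltn_pmod #|D| (isT : 0 < 4).
    by rewrite -/j; move: leD D4; move: #|D| #|moved p| => a b; lia.
  have As : tperms s \in 'Alt_T.
    rewrite Alt_even odd_tperms ?es ?oddM //.
    by rewrite (_ : (4 * j)./2 = 2 * j)%N ?oddM //; lia.
  have sV : tperms s = (tperms s)^-1.
    by apply: (mulgI (tperms s)); rewrite mulgV tperms_sq.
  have -> : tperms (map p s ++ s) = p^-1 * p ^ tperms s.
    rewrite tperms_cat ?size_map ?es ?oddM // tperms_map.
    by rewrite /conjg -sV !mulgA.
  apply: (@sub_class_ball _ _ _ (1 + 1)); first by rewrite leq_maxl.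
  by rewrite class_ballM ?class_ballV ?class_ballJ ?class_ball_id.
have [x0 _] : exists x : T, x \in T by apply/card_gt0P; apply: leq_trans T5.
(* Moved points come first, so truncation at nine loses none; fixed points fill the list up to at
   least five, where simplicity applies. *)
pose e := take 9 (enum (moved p) ++ enum (~: moved p)).
have ue : uniq e.
  rewrite take_uniq // cat_uniq !enum_uniq andbT /=.
  by apply/hasPn=> x; rewrite !mem_enum !inE.
have le9 : #|moved p| <= 9 by move: leD D3; move: #|D| => a; lia.
have se : 5 <= size e <= 9.
  rewrite size_take size_cat -!cardE.
  have := cardsC (moved p).
  move: #|moved p| #|~: moved p| => a b h; move: T5; rewrite -h.
  by case: (ltnP 9) => k9 k5; rewrite ?k5 ?k9.
have me : {subset moved p <= e}.
  move=> x px; rewrite /e take_cat -cardE ltnNge le9 /= mem_cat mem_enum px //.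
pose phi (i : 'I_(size e)) := nth x0 e i.
have phi_inj : injective phi.
  by move=> i j /eqP; rewrite nth_uniq // => /eqP/val_inj.
have [q Eq] : exists q, perm_ext phi_inj q = p.
  apply: perm_ext_onto => x /me xe; apply/codomP.
  have ix : index x e < size e by rewrite index_mem.
  by exists (Ordinal ix); rewrite /phi nth_index.
have Aq : q \in 'Alt_('I_(size e)) by rewrite Alt_even -(odd_perm_ext phi_inj) Eq -Alt_even.
have q1 : q != 1 by apply: contraNneq p1 => q1; rewrite -Eq q1 perm_ext1.
have [i5 i9] := andP se.
pose o k (hk : k < 5) : 'I_(size e) := Ordinal (leq_trans hk i5).
pose v := [:: o 0%N isT; o 1%N isT; o 2%N isT; o 3%N isT].
have uv : uniq v by [].
exists 1%N, (map phi v); split=> //; first by rewrite map_inj_uniq.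
  by rewrite muln1; apply: leq_trans le9 _.
have -> : tperms (map phi v) = perm_ext phi_inj (tperms v).
  by rewrite /= !mulg1 perm_extM !perm_ext_tperm.
apply: (@sub_class_ball _ _ _ K0); first by rewrite leq_maxr.
rewrite -Eq; apply: (@class_ball_morph _ _ 'Alt_('I_(size e))%G).
- exact: perm_extM.
- by move=> g; rewrite !Alt_even odd_perm_ext.
by apply: (subsetP (K0P _ _ se Aq q1)); rewrite Alt_even odd_tperms.
Qed.

(** The 4 in the bound makes every 3-cycle reachable from any nontrivial [p], however few points [p]
    moves. *)
Theorem Alt_class_ball :
  exists K, forall (T : finType) (p q : {perm T}),
    5 <= #|T| -> p \in 'Alt_T -> q \in 'Alt_T -> p != 1 ->
    #|moved q| <= maxn 4 #|moved p| ->
  q \in class_ball 'Alt_T p K.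
Proof.
have [K KP] := perm_ball_tperms; exists (16 * K)%N => T p q T5 Ap Aq p1 le.
have [l [u [l0 uu eu lel pu]]] := KP _ _ T5 Ap p1.
apply: class_ball_trans pu _; apply: (even_perm_ball _ _ uu eu) => //.
by apply: leq_trans le _; rewrite geq_max lel andbT; lia.
Qed.

(** * Lifts of 3-cycles to the double cover *)

Lemma uniq3 (T : eqType) (x y w : T) :
  uniq [:: x; y; w] = [&& x != y, x != w & y != w].
Proof. by rewrite /= !inE negb_or andbT andbA. Qed.

Lemma uniq4 (T : eqType) (x y z w : T) :
  uniq [:: x; y; z; w] = [&& x != y, x != z, x != w & uniq [:: y; z; w]].
Proof. by rewrite cons_uniq !inE !negb_or !andbA. Qed.

Section ThreeCycles.

Variable T : finType.
Implicit Types x y w : T.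

(** Products act from left to right, so on distinct points this is [x -> y -> w -> x]. *)
Definition cycle3 x y w : {perm T} := tperm x y * tperm x w.

Ltac perm_cases := by apply/permP=> ?; rewrite /cycle3 !permM; do ?case: tpermP; congruence.

Lemma cycle3J x y w g : cycle3 x y w ^ g = cycle3 (g x) (g y) (g w).
Proof. by rewrite conjMg !tpermJ. Qed.

Lemma cycle3_rot x y w :
  uniq [:: x; y; w] -> cycle3 x y w = cycle3 y w x.
Proof.
rewrite uniq3 => /and3P[/eqP xy /eqP xw /eqP yw].
perm_cases.
Qed.

Lemma cycle3V x y w : (cycle3 x y w)^-1 = cycle3 x w y.
Proof. by rewrite invMg !tpermV. Qed.

Lemma cycle3_sq x y w :
  uniq [:: x; y; w] -> cycle3 x y w * cycle3 x y w = cycle3 x w y.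
Proof.
rewrite uniq3 => /and3P[/eqP xy /eqP xw /eqP yw].
perm_cases.
Qed.

(** The two inner transpositions cancel. Failure of this relation on lifts will produce the
    nontrivial kernel element. *)
Lemma cycle3M x y y' w :
  uniq [:: x; y; y'; w] ->
  cycle3 x y w = cycle3 x y y' * cycle3 x y' w.
Proof. by move=> _; rewrite /cycle3 -mulgA tpermKg. Qed.

Lemma cycle3_Alt x y w : uniq [:: x; y; w] -> cycle3 x y w \in 'Alt_T.
Proof.
rewrite uniq3 => /and3P[xy xw yw].
by rewrite Alt_even odd_permM !odd_tperm xy xw.
Qed.

Lemma cycle3_moved x y w : #|moved (cycle3 x y w)| <= 4.
Proof.
apply: leq_trans (_ : #|[set z in [:: x; y; w]]| <= 4); last first.
  by rewrite cardsE; apply: leq_trans (card_size _) _.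
apply/subset_leq_card/subsetP=> z; rewrite !inE; apply: contraR.
by rewrite !negb_or permM => /and3P[zx zy zw]; rewrite !tpermD // eq_sym.
Qed.

End ThreeCycles.

(** In a finite group, products of generators without inverses already form the generated
    subgroup. *)
Lemma gen_ind_r (gT : finGroupType) (A : {set gT}) (P : gT -> Prop) :
    P 1 -> (forall a b, P a -> b \in A -> P (a * b)) ->
  forall h, h \in <<A>> -> P h.
Proof.
move=> P1 PM; have [m ->] := gen_expgs A; elim: m => [|m IH] h.
  by rewrite expg0 => /set1gP->.
rewrite expgSr => /mulsgP[a b /IH Pa + ->].
by case/setU1P=> [->|/PM]; [rewrite mulg1|apply].
Qed.

Section Cover.

Variables (gT : finGroupType) (T : finType).
Variable f : {morphism [set: gT] >-> {perm T}}.
Hypothesis T5 : 5 <= #|T|.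
Hypothesis perfG : [~: [set: gT], [set: gT]] = [set: gT].
Hypothesis imf : f @* [set: gT] = 'Alt_T.
Hypothesis kerZ : 'ker f \subset 'Z([set: gT]).
Hypothesis ker2 : #|'ker f| = 2.
Implicit Types (a g h k : gT) (x y w q u v i b : T) (S : {set T}).

Let fM (a b : gT) : f (a * b) = f a * f b. Proof. exact: (morphM f (in_setT a) (in_setT b)). Qed.
Let fV a : f a^-1 = (f a)^-1. Proof. exact: (morphV f (in_setT a)). Qed.
Let fJ (a b : gT) : f (a ^ b) = f a ^ f b. Proof. exact: (morphJ f (in_setT a) (in_setT b)). Qed.
Let f1 : f 1 = 1. Proof. exact: (morph1 f). Qed.
Let fX a m : f (a ^+ m) = f a ^+ m. Proof. exact: (morphX f _ (in_setT a)). Qed.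
Let kerE a : (a \in 'ker f) = (f a == 1).
Proof. by rewrite !inE /=. Qed.
Let fAlt a : f a \in 'Alt_T. Proof. by rewrite -imf mem_morphim. Qed.
Let Alt_f p : p \in 'Alt_T -> exists a, f a = p.
Proof. by rewrite -imf => /morphimP[a _ _ ->]; exists a. Qed.

Lemma ker_cover_central k a : f k = 1 -> k * a = a * k.
Proof.
move=> fk; have : k \in 'Z([set: gT]) by apply: (subsetP kerZ); rewrite kerE fk.
by case/centerP=> _ /(_ a (in_setT _)).
Qed.

Lemma ker_cover_sq k : f k = 1 -> k * k = 1.
Proof.
move=> fk; have : k \in 'ker f by rewrite kerE fk.
by move/order_dvdG; rewrite ker2 order_dvdn expgS expg1 => /eqP.
Qed.

Lemma ker_cover_eq k k' : f k = 1 -> f k' = 1 -> k != 1 -> k' != 1 -> k = k'.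
Proof.
move=> fk fk' k1 k1'; apply/eqP; apply: contraT => ne.
suffices : 2 < #|'ker f| by rewrite ker2.
apply/card_gt2P; exists 1, k, k'; rewrite !kerE fk fk' f1 !eqxx.
by rewrite eq_sym k1 k1' ne.
Qed.

(* On a 3-cycle this is the unique lift of order 3: the fourth power erases the choice of a lift. *)
Definition lift4 (p : {perm T}) : gT := repr (f @*^-1 [set p]) ^+ 4.

Lemma lift4E a : lift4 (f a) = a ^+ 4.
Proof.
rewrite /lift4; set r := repr _.
have fr : f r = f a.
  have : r \in f @*^-1 [set f a] by rewrite /r (@mem_repr _ _ a) // !inE /=. 
  by rewrite !inE => /eqP.
pose k := r * a^-1.
have fk : f k = 1 by rewrite fM fV fr mulgV.
have -> : r = k * a by rewrite mulgKV.
rewrite expgMn; last exact: ker_cover_central.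
have k2 : k ^+ 2 = 1 by rewrite expgS expg1 ker_cover_sq.
by rewrite (expgM k 2 2) k2 expg1n mul1g.
Qed.

Lemma lift4J p g : p \in 'Alt_T -> lift4 p ^ g = lift4 (p ^ f g).
Proof. by case/Alt_f=> a <-; rewrite -fJ !lift4E conjXg. Qed.

Lemma lift4V p : p \in 'Alt_T -> lift4 p^-1 = (lift4 p)^-1.
Proof. by case/Alt_f=> a <-; rewrite -fV !lift4E expgVn. Qed.

Lemma lift4_sq p : p \in 'Alt_T -> lift4 (p * p) = lift4 p * lift4 p.
Proof.
by case/Alt_f=> a <-; rewrite -fM !lift4E expgMn.
Qed.

Lemma f_lift4 p : p \in 'Alt_T -> f (lift4 p) = p ^+ 4.
Proof. by case/Alt_f=> a <-; rewrite lift4E fX. Qed.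

Definition lift3 x y w := lift4 (cycle3 x y w).

Lemma f_lift3 x y w : uniq [:: x; y; w] -> f (lift3 x y w) = cycle3 x y w.
Proof.
move=> u; have u' : uniq [:: x; w; y].
  by move: u; rewrite !uniq3 (eq_sym w) => /and3P[-> -> ->].
have sq p : p ^+ 2 = p * p :> {perm T} by rewrite expgS expg1.
by rewrite f_lift4 ?cycle3_Alt // (expgM _ 2 2) !sq !cycle3_sq.
Qed.

Lemma lift3_rot x y w : uniq [:: x; y; w] -> lift3 x y w = lift3 y w x.
Proof. by move=> u; rewrite /lift3 cycle3_rot. Qed.

Lemma lift3V x y w : uniq [:: x; y; w] -> lift3 x w y = (lift3 x y w)^-1.
Proof. by move=> u; rewrite /lift3 -cycle3V lift4V ?cycle3_Alt. Qed.

Lemma lift3_sq x y w :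
  uniq [:: x; y; w] -> lift3 x y w * lift3 x y w = lift3 x w y.
Proof. by move=> u; rewrite /lift3 -(cycle3_sq u) lift4_sq ?cycle3_Alt. Qed.

Lemma lift3J x y w g : uniq [:: x; y; w] ->
  lift3 x y w ^ g = lift3 (f g x) (f g y) (f g w).
Proof. by move=> u; rewrite /lift3 lift4J ?cycle3_Alt // cycle3J. Qed.

(** * Lifts obeying the relation of 3-cycles, assumed for contradiction *)

Section Splitting.

Hypothesis liftM : forall x y y' w, uniq [:: x; y; y'; w] ->
  lift3 x y w = lift3 x y y' * lift3 x y' w.

Definition lift3s S : {set gT} :=
  [set h | [exists x in S, exists y in S, exists w in S,
            uniq [:: x; y; w] && (h == lift3 x y w)]].

Lemma lift3sP S h :
  reflect (exists x y w, [/\ x \in S, y \in S, w \in S, uniq [:: x; y; w] &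
                             h = lift3 x y w]) (h \in lift3s S).
Proof.
rewrite inE; apply: (iffP exists_inP).
  case=> x xS /exists_inP[y yS /exists_inP[w wS /andP[u /eqP->]]].
  by exists x, y, w.
case=> x [y [w [xS yS wS u ->]]]; exists x => //.
by apply/exists_inP; exists y => //; apply/exists_inP; exists w => //; rewrite u /=.
Qed.

Lemma mem_lift3s S x y w : x \in S -> y \in S -> w \in S -> uniq [:: x; y; w] ->
  lift3 x y w \in <<lift3s S>>.
Proof. by move=> *; apply: mem_gen; apply/lift3sP; exists x, y, w. Qed.

Lemma lift3s_fix S h x : h \in <<lift3s S>> -> x \notin S -> f h x = x.
Proof.
move=> hS xS; move: h hS; apply: gen_ind_r => [|a b fa]; first by rewrite f1 perm1.
case/lift3sP=> y [w [v [yS wS vS u ->]]]; rewrite fM permM fa f_lift3 //.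
rewrite permM !tpermD //.
all: by apply: contraNneq xS => <-.
Qed.

(* The coset of [<<lift3s S>>] containing [lift3 i q b] is determined by [b],
   the image of [q]: by [liftM] the point [i] may be changed freely. *)
Definition lift_coset S q h :=
  h \in <<lift3s S>> \/
  exists a i b, [/\ a \in <<lift3s S>>, i \in S, b \in S, i != b
                  & h = a * lift3 i q b].

(** The new factor passes to the left of [lift3 i q b] by conjugating it; its image fixes [q] and
    preserves [S], so only [i] and [b] change, within [S]. *)
Lemma lift_coset_inner S q h u v w :
    q \notin S -> u \in S -> v \in S -> w \in S -> uniq [:: u; v; w] ->
  lift_coset S q h -> lift_coset S q (h * lift3 u v w).
Proof.
move=> qS uS vS wS uu; have tS := mem_lift3s uS vS wS uu.
case=> [hS|[a [i [b [aS iS bS ib ->]]]]]; first by left; rewrite groupM.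
have uiqb : uniq [:: i; q; b].
  rewrite uniq3 ib /=; apply/andP; split; first by apply: contraNneq qS => <-.
  by apply: contraNneq qS => ->.
right; rewrite -mulgA (conjgC (lift3 i q b)) lift3J // mulgA f_lift3 //.
have inS x : x \in S -> cycle3 u v w x \in S.
  by rewrite permM => xS; do 2?case: tpermP => // *; subst.
have -> : cycle3 u v w q = q.
  by rewrite -f_lift3 // (lift3s_fix tS).
exists (a * lift3 u v w), (cycle3 u v w i), (cycle3 u v w b).
by rewrite groupM // !inS // (inj_eq perm_inj).
Qed.

(** Rotated so as to start at [b], this is [liftM] with inner factor [lift3 b i i']. *)
Lemma lift3_change S q (i i' : T) b :
    q \notin S -> i \in S -> i' \in S -> b \in S -> i != b -> i' != b ->
  exists2 a, a \in <<lift3s S>> & lift3 i q b = a * lift3 i' q b.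
Proof.
move=> qS iS i'S bS ib i'b.
have [<-|ii'] := eqVneq i i'; first by exists 1; rewrite ?group1 ?mul1g.
have qN x : x \in S -> x != q by move=> xS; apply: contraNneq qS => <-.
exists (lift3 b i i').
  by apply: mem_lift3s; rewrite // uniq3 ii' !(eq_sym b) ib i'b.
have jbq j : j \in S -> j != b -> lift3 j q b = lift3 b j q.
  by move=> jS jb; rewrite -lift3_rot // uniq3 (eq_sym b) jb !qN.
rewrite !jbq //; apply: liftM.
by rewrite uniq4 uniq3 ii' !qN // !(eq_sym b) ib i'b.
Qed.

(** Changing [i] suitably makes the two lifts mutually inverse if [b = u], equal if [b = v], and
    composable by [liftM] after rotation otherwise. *)
Lemma lift_coset_outer S q h u v :
    q \notin S -> u \in S -> v \in S -> u != v ->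
  lift_coset S q h -> lift_coset S q (h * lift3 u q v).
Proof.
move=> qS uS vS uv.
have qN x : x \in S -> x != q by move=> xS; apply: contraNneq qS => <-.
have vu : v != u by rewrite eq_sym.
have qN' x : x \in S -> q != x by move=> xS; rewrite eq_sym qN.
case=> [hS|[a [i [b [aS iS bS ib ->]]]]]; first by right; exists h, u, v.
have [bu|bu] := eqVneq b u.
  have [|a' a'S ->] := lift3_change qS iS vS bS ib.
    by rewrite bu eq_sym.
  left; rewrite bu.
  have -> : lift3 u q v = (lift3 v q u)^-1.
    rewrite -lift3V; last by rewrite uniq3 !(qN, qN') // ?uv ?vu.
    by rewrite -lift3_rot // uniq3 !(qN, qN') // ?uv ?vu.
  by rewrite mulgA mulgK groupM.
have [bv|bv] := eqVneq b v.
  have [|a' a'S ->] := lift3_change qS iS uS bS ib; first by rewrite bv.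
  right; exists (a * a'), v, u; rewrite groupM // uS vS eq_sym uv; split=> //.
  suffices <- : lift3 u q v * lift3 u q v = lift3 v q u by rewrite bv !mulgA.
  rewrite lift3_sq; last by rewrite uniq3 !(qN, qN') // ?uv ?vu.
  by rewrite lift3_rot // uniq3 !(qN, qN') // ?uv ?vu.
have [|a' a'S ->] := lift3_change qS iS vS bS ib; first by rewrite eq_sym.
right; exists (a * a'), u, b; rewrite groupM // uS bS eq_sym bu; split=> //.
suffices <- : lift3 v q b * lift3 u q v = lift3 u q b by rewrite !mulgA.
have vb : v != b by rewrite eq_sym.
have ub : u != b by rewrite eq_sym.
have -> : lift3 v q b = lift3 q b v.
  by rewrite lift3_rot // uniq3 !(qN, qN') // vb.
have -> : lift3 u q v = lift3 q v u.
  by rewrite lift3_rot // uniq3 !(qN, qN') // ?uv ?vu.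
have -> : lift3 u q b = lift3 q b u.
  by rewrite lift3_rot // uniq3 !(qN, qN') // ub.
by rewrite -liftM // uniq4 uniq3 !(qN, qN') // bu bv ?uv ?vu.
Qed.

(** A generator either avoids [q] or can be rotated to have [q] in the middle, so right
    multiplication by generators preserves the cosets. *)
Lemma lift3s_coset S q h :
  q \notin S -> h \in <<lift3s (q |: S)>> -> lift_coset S q h.
Proof.
move=> qS; move: h; apply: gen_ind_r => [|a b ha].
  by left; rewrite group1.
case/lift3sP=> x [y [w [xS yS wS u ->]]].
have u' : uniq [:: y; w; x].
  by move: u; rewrite !uniq3 !(eq_sym _ x) => /and3P[-> -> ->].
have u'' : uniq [:: w; x; y].
  by move: u'; rewrite !uniq3 !(eq_sym _ y) => /and3P[-> -> ->].
have out z : z \in q |: S -> z != q -> z \in S by case/setU1P=> [->|//]; rewrite eqxx.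
have [xq|xq] := eqVneq x q.
  move: u u' u''; rewrite xq => u u' u''; rewrite (lift3_rot u) (lift3_rot u').
  move: u; rewrite uniq3 => /and3P[qy qw yw].
  by apply: lift_coset_outer => //; [apply: out|apply: out|]; rewrite // eq_sym.
have [yq|yq] := eqVneq y q.
  move: u u' u''; rewrite yq => u u' u''.
  move: u''; rewrite uniq3 => /and3P[wx wq _].
  by apply: lift_coset_outer => //; [apply: out|apply: out|rewrite eq_sym].
have [wq|wq] := eqVneq w q.
  move: u u' u''; rewrite wq => u u' u''; rewrite (lift3_rot u).
  move: u; rewrite uniq3 => /and3P[xy _ _].
  by apply: lift_coset_outer => //; [apply: out|apply: out|rewrite eq_sym].
by apply: lift_coset_inner => //; apply: out.
Qed.

(** Remove a point [q] from [S]. Outside the subgroup for the smaller set, the image of [h] sends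
    [q] to some [b] other than [q], so a kernel element lies in that subgroup and induction
    applies. *)
Lemma lift3s_inj S h : h \in <<lift3s S>> -> f h = 1 -> h = 1.
Proof.
have [m] := ubnP #|S|; elim: m S h => // m IH S h /ltnSE leS hS fh.
have [S0|[q qS]] := set_0Vmem S.
  move: hS; rewrite (_ : lift3s S = set0) ?gen0; first by move/set1gP.
  apply/setP=> a; rewrite in_set0; apply/negP=> /lift3sP[x [y [w []]]].
  by rewrite S0 inE.
pose S' := S :\ q; have qS' : q \notin S' by rewrite !inE eqxx.
have ltS' : #|S'| < m by apply: leq_trans leS; rewrite [ltnRHS](cardsD1 q) qS.
have [] := @lift3s_coset S' q h qS'; first by rewrite setD1K.
  by move=> hS'; apply: IH hS' fh.
case=> a [i [b [aS iS bS ib hE]]].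
have qN x : x \in S' -> x != q by rewrite !inE => /andP[].
move/permP/(_ q): fh; rewrite hE fM permM perm1 (lift3s_fix aS) // f_lift3; last first.
  by rewrite uniq3 ib (eq_sym q) !qN.
rewrite permM tpermR tpermL => bq.
by move: (qN b bS); rewrite bq eqxx.
Qed.

(** The lifts generate a normal subgroup [H], mapped onto the alternating group by simplicity. As
    the kernel is central, every commutator is one of elements of [H], so perfectness makes [H]
    everything, although it meets the kernel trivially. *)
Lemma lift3M_absurd : False.
Proof.
pose H := <<lift3s [set: T]>>%G.
have nH : H <| [set: gT].
  rewrite /normal subsetT; apply: subset_trans (norm_gen _).
  apply/subsetP=> g _; rewrite inE; apply/subsetP=> _ /imsetP[h + ->].
  case/lift3sP=> x [y [w [_ _ _ u ->]]]; rewrite lift3J //.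
  apply/lift3sP; exists (f g x), (f g y), (f g w); split; rewrite ?inE //.
  by rewrite (map_inj_uniq (@perm_inj _ (f g)) [:: x; y; w]).
have := morphim_normal f nH; rewrite imf => nfH.
have [x [y [w [_ [xy yw wx]]]]] : exists x y z : T,
    [/\ x \in T, y \in T & z \in T] /\ [/\ x != y, y != z & z != x].
  by apply/card_gt2P; apply: leq_trans T5.
have u : uniq [:: x; y; w] by rewrite uniq3 xy yw eq_sym wx.
have fH : f @* H = 'Alt_T.
  have [_ simA] := simpleP _ (simple_Alt5 T5).
  case: (simA _ nfH) => //= fH1.
  have : f (lift3 x y w) \in f @* H.
    by apply: mem_morphim; rewrite ?inE // mem_lift3s ?inE.
  rewrite fH1 => /set1gP; rewrite f_lift3 // => /permP/(_ x).
  rewrite permM perm1 tpermL tpermD // 1?eq_sym // => xy'.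
  by rewrite xy' eqxx in xy.
have decomp g : exists h k, [/\ h \in H, f k = 1 & g = h * k].
  have : f g \in f @* H by rewrite fH fAlt.
  case/morphimP=> h _ hH fgh; exists h, (h^-1 * g); split=> //.
    by rewrite fM fV fgh mulVg.
  by rewrite mulKVg.
have HG : [set: gT] \subset H.
  rewrite -perfG gen_subG; apply/subsetP=> _ /imset2P[a b _ _ ->].
  have [h [k [hH fk ->]]] := decomp a; have [h' [k' [hH' fk' ->]]] := decomp b.
  suffices -> : [~ h * k, h' * k'] = [~ h, h'] by rewrite groupR.
  have cj c k0 : f k0 = 1 -> c ^ k0 = c.
    by move=> fk0; rewrite /conjg -(ker_cover_central c fk0) mulKg.
  have kh : k ^ h' = k by rewrite /conjg (ker_cover_central h' fk) mulKg.
  by rewrite !commgEl conjgM cj // conjMg kh invMg !mulgA -[RHS](cj _ k) // /conjg !mulgA.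
have : 'ker f \subset [1].
  apply/subsetP=> k; rewrite kerE => /eqP fk; apply/set1gP.
  by apply: (@lift3s_inj [set: T]) fk; apply: (subsetP HG); rewrite inE.
by move/subset_leq_card; rewrite ker2 cards1.
Qed.

End Splitting.

Lemma lift3M_fails : exists x y y' w,
  uniq [:: x; y; y'; w] /\ lift3 x y w != lift3 x y y' * lift3 x y' w.
Proof.
have [/existsP[x /existsP[y /existsP[y' /existsP[w /andP[u ne]]]]]|] := boolP
  [exists x, exists y, exists y', exists w,
   uniq [:: x; y; y'; w] && (lift3 x y w != lift3 x y y' * lift3 x y' w)].
  by exists x, y, y', w.
move=> no; case: lift3M_absurd => x y y' w u; apply/eqP; apply: contraNT no => ne.
by apply/existsP; exists x; apply/existsP; exists y; apply/existsP; exists y';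
   apply/existsP; exists w; rewrite u.
Qed.

(** Conjugating elements have preimages, so a product lifts factor by factor, but only to some
    preimage of [p]. *)
Lemma class_ball_lift a p m : p \in class_ball 'Alt_T (f a) m ->
  exists2 b : gT, b \in class_ball [set: gT] a m & f b = p.
Proof.
elim: m p => [|m IH] p.
  rewrite /class_ball expg0 => /set1gP->; exists 1; last exact: f1.
  by rewrite expg0 set11.
rewrite {1}/class_ball expgS => /mulsgP[q r + /IH[b ab <-] ->].
rewrite !inE => qa; suffices [c ac <-] : exists2 c, c \in class_ball [set: gT] a 1 & f c = q.
  by exists (c * b); rewrite ?fM // -add1n class_ballM.
case/or3P: qa => [/eqP->|/imsetP[g /Alt_f[g' <-] ->]|/imsetP[g /Alt_f[g' <-] ->]].
- by exists 1; rewrite ?class_ball1.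
- by exists (a ^ g'); rewrite ?fJ // class_ballJ ?class_ball_id ?inE.
- by exists (a^-1 ^ g'); rewrite ?fJ ?fV // class_ballJ ?class_ballV ?class_ball_id ?inE.
Qed.

(** * Bounded generation in the cover *)

Variable K : nat.
Hypothesis AltK : forall p q : {perm T},
  p \in 'Alt_T -> q \in 'Alt_T -> p != 1 -> #|moved q| <= maxn 4 #|moved p| ->
  q \in class_ball 'Alt_T p K.

(** Some lift of a 3-cycle lies in the ball of radius [K], and its fourth power [lift3] in that of
    radius [4 K]. Three such factors give the only nontrivial kernel element. *)
Lemma ker_cover_ball a k : f a != 1 -> f k = 1 ->
  k \in class_ball [set: gT] a (12 * K).
Proof.
move=> fa fk; have [->|k1] := eqVneq k 1; first exact: class_ball1.
have lift3_in x y w : uniq [:: x; y; w] ->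
    lift3 x y w \in class_ball [set: gT] a (4 * K).
  move=> u; have [|b ab fb] := @class_ball_lift a (cycle3 x y w) K.
    apply: AltK => //; first exact: cycle3_Alt.
    by rewrite leq_max cycle3_moved.
  by rewrite /lift3 -fb lift4E class_ballX.
have [x [y [y' [w [u ne]]]]] := lift3M_fails.
have [u1 u2 u3] : [/\ uniq [:: x; y; w], uniq [:: x; y; y'] & uniq [:: x; y'; w]].
  by move: u; rewrite uniq4 !uniq3 => /and4P[-> -> -> /and3P[-> -> ->]].
(* The discrepancy in a failing relation is a nontrivial element of the kernel. *)
pose k' := (lift3 x y w)^-1 * (lift3 x y y' * lift3 x y' w).
have -> : k = k'.
  apply: ker_cover_eq => //.
    by rewrite /k' 2!fM fV !f_lift3 // -(cycle3M u) mulVg.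
  by apply: contra ne; rewrite -eq_invg_mul invgK.
have -> : (12 * K = 4 * K + (4 * K + 4 * K))%N by lia.
apply: class_ballM; first by apply: class_ballV; apply: lift3_in.
by apply: class_ballM; apply: lift3_in.
Qed.

(** A preimage of [f b] is reached with radius [K], and the kernel error costs [12 K] more. *)
Lemma cover_ball_le (a b : gT) : #|moved (f b)| <= #|moved (f a)| -> f a != 1 ->
  b \in class_ball [set: gT] a (13 * K).
Proof.
move=> le fa; have [|c ac fc] := @class_ball_lift a (f b) K.
  by apply: AltK => //; rewrite leq_max le orbT.
have -> : b = c * (c^-1 * b) by rewrite mulKVg.
have -> : (13 * K = K + 12 * K)%N by lia.
by rewrite class_ballM // ker_cover_ball // fM fV fc mulVg.
Qed.

(** If the image moving more points is trivial, both elements lie in the kernel of order 2. The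
    successor keeps the radius positive, as needed when they are the same nontrivial element. *)
Lemma cover_ball_total (a b : gT) :
  a \in class_ball [set: gT] b (13 * K).+1 \/ b \in class_ball [set: gT] a (13 * K).+1.
Proof.
wlog le : a b / #|moved (f b)| <= #|moved (f a)|.
  by move=> W; case: (leqP #|moved (f b)| #|moved (f a)|) => [|/ltnW] /W [] ; auto.
have [fa|fa] := eqVneq (f a) 1; last first.
  by right; apply: sub_class_ball (cover_ball_le le fa).
have fb : f b = 1.
  apply/permP=> x; rewrite perm1; apply/eqP; rewrite -notin_moved.
  have : #|moved (f a)| == 0.
    by rewrite cards_eq0; apply/eqP/setP=> z; rewrite !inE fa perm1 eqxx.
  by move/eqP=> e; move: le; rewrite e leqn0 cards_eq0 => /eqP->; rewrite inE.
have [->|a1] := eqVneq a 1; first by left; apply: class_ball1.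
have [->|b1] := eqVneq b 1; first by right; apply: class_ball1.
left; rewrite (ker_cover_eq fa fb a1 b1).
by apply: (@sub_class_ball _ _ _ 1); rewrite ?class_ball_id.
Qed.

End Cover.

Theorem double_cover_ball : exists K, forall n (gT : finGroupType),
  5 <= n -> double_cover n gT -> forall a b : gT,
  a \in class_ball [set: gT] b K \/ b \in class_ball [set: gT] a K.
Proof.
have [K KP] := Alt_class_ball; exists (13 * K).+1 => n gT n5 [perfG [f [imf kerZ ker2]]].
have T5 : 5 <= #|'I_n| by rewrite card_ord.
by apply: (cover_ball_total T5 perfG imf kerZ ker2) => p q; apply: KP.
Qed.

(** * Ultraproducts *)

From mathcomp Require Import boolp classical_sets filter.

Section UltraproductTransfer.

Variables (I : Type) (U : set_system I) (UU : UltraFilter U).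
Variable A : I -> finGroupType.

Notation P := (product_group (fun i => A i)).
Notation Q := (ultraproduct UU (fun i => A i)).
Notation cls := (Defs.quotient_class (@ultraproduct_kernel_normal I U UU (fun i => A i))).

Lemma ultraproduct_class_eq (x y : P) :
  U [set i | x i = y i]%classic -> cls x = cls y.
Proof.
move=> Uxy; apply/eqP; rewrite Defs.quotient_class_eq inE /=.
apply: filterS Uxy => i /= e.
by rewrite [LHS](_ : _ = (x i)^-1 * y i)%g // e mulVg.
Qed.

Section Normal.

Variable N : set Q.
Hypothesis nN : normal_subgroup N.

Let cls1 : cls 1%g = 1%g.
Proof. by []. Qed.

Let clsV (x : P) : cls x^-1%g = (cls x)^-1%g.
Proof. by apply: (mulgI (cls x)); rewrite mulgV -Defs.quotient_classM mulgV cls1. Qed.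

Let clsJ (x g : P) : cls (x ^ g)%g = (cls x ^ cls g)%g.
Proof. by rewrite /conjg !Defs.quotient_classM clsV. Qed.

Let N1 : 1%g \in N. Proof. by case: nN => -[]. Qed.

Let NV u : u \in N -> u^-1%g \in N.
Proof. by case: nN => -[_ ND] _ Nu; rewrite -[u^-1%g]mul1g; apply: ND. Qed.

Let NM u v : u \in N -> v \in N -> (u * v)%g \in N.
Proof.
by move=> Nu /NV Nv; rewrite -[v]invgK; case: nN => -[_ ND] _; apply: ND.
Qed.

Let NJ u g : u \in N -> (u ^ g)%g \in N.
Proof. by case: nN => _; apply. Qed.

(** As [K] does not depend on the index, one factor at a time can be split off at all indices
    simultaneously. The ultrafilter decides whether that factor is 1, a conjugate of [x], or a
    conjugate of its inverse. *)
Lemma ultraproduct_ball_normal K (x y : P) :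
    U [set i | y i \in class_ball [set: A i] (x i) K]%classic ->
  cls x \in N -> cls y \in N.
Proof.
move=> + Nx; elim: K y => [|K IH] y Uy.
  rewrite (@ultraproduct_class_eq y 1%g) ?cls1 //.
  by apply: filterS Uy => i /=; rewrite /class_ball expg0 => /set1gP.
(* The triple holds the first factor, the remaining product and the conjugating element; where [y i]
   is outside the ball it defaults to 1, so that choice works at every index. *)
have ex i : exists w : A i * A i * A i,
    y i \in class_ball [set: A i] (x i) K.+1 ->
  [/\ y i = (w.1.1 * w.1.2)%g, w.1.2 \in class_ball [set: A i] (x i) K &
      [\/ w.1.1 = 1%g, w.1.1 = (x i ^ w.2)%g | w.1.1 = ((x i)^-1 ^ w.2)%g]].
  have [|no] := boolP (y i \in class_ball [set: A i] (x i) K.+1); last by exists (1%g, 1%g, 1%g).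
  rewrite {1}/class_ball expgS => /mulsgP[a b + xb ->].
  rewrite !inE => /or3P[/eqP->|/imsetP[g _ ->]|/imsetP[g _ ->]].
  - by exists (1%g, b, 1%g); split=> //; apply: Or31.
  - by exists ((x i ^ g)%g, b, g); split=> //; apply: Or32.
  - by exists (((x i)^-1 ^ g)%g, b, g); split=> //; apply: Or33.
pose w i := sval (cid (ex i)); have wP i := svalP (cid (ex i)).
pose e : P := fun i => (w i).1.1; pose u : P := fun i => (w i).1.2.
pose g : P := fun i => (w i).2.
have -> : cls y = (cls e * cls u)%g.
  rewrite -Defs.quotient_classM; apply: ultraproduct_class_eq.
  by apply: filterS Uy => i /= /wP[].
have Nu : cls u \in N by apply: IH; apply: filterS Uy => i /= /wP[].
apply: NM => //.
have [U1|U1] := in_ultra_setVsetC [set i | e i = 1%g]%classic UU.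
  by rewrite (@ultraproduct_class_eq e 1%g) // cls1.
have [U2|U2] := in_ultra_setVsetC [set i | e i = (x i ^ g i)%g]%classic UU.
  by rewrite (@ultraproduct_class_eq e (x ^ g)%g) // clsJ NJ.
rewrite (@ultraproduct_class_eq e (x^-1 ^ g)%g); first by rewrite clsJ clsV NJ ?NV.
by apply: filterS3 Uy U1 U2 => i /= /wP[_ _ []].
Qed.

End Normal.

End UltraproductTransfer.

Theorem mainTheorem3 (I : Type) (n : I -> nat) (n_ge5 : forall i, (5 <= n i)%N)
    (U : set_system I) (UU : UltraFilter U)
    (A : I -> finGroupType) (A_cover : forall i, double_cover (n i) (A i))
    (N1 N2 : set (ultraproduct UU (fun i => A i))) :
  normal_subgroup N1 -> normal_subgroup N2 ->
  (N1 `<=` N2 \/ N2 `<=` N1)%classic.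
Proof.
move=> nN1 nN2; have [|/existsNP[u /not_implyP[N1u N2u]]] := pselect (N1 `<=` N2)%classic.
  by left.
right=> v N2v.
have [x Ex] := Defs.quotient_class_surj u; have [y Ey] := Defs.quotient_class_surj v.
have [K total] := double_cover_ball.
(* The ultrafilter decides which representative is almost everywhere in the ball of the other; the
   first alternative would put [u] in [N2]. *)
have [Uxy|Uyx] := in_ultra_setVsetC
  [set i | x i \in class_ball [set: A i] (y i) K]%classic UU.
  have : Defs.quotient_class _ x \in N2.
    by apply: (@ultraproduct_ball_normal I U UU A N2 nN2 K y x Uxy); rewrite Ey inE.
  by rewrite Ex inE.
have : Defs.quotient_class _ y \in N1.
  apply: (@ultraproduct_ball_normal I U UU A N1 nN1 K x y); last by rewrite Ex inE.
  by apply: filterS Uyx => i /=; case: (total _ _ (n_ge5 i) (A_cover i) (x i) (y i)).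
by rewrite Ey inE.
Qed.
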